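(* Let $M=(E,\mathcal I)$ be a loopless matroid with rank function $r$ and base family $\mathcal B$, let $\widetilde{\mathcal B}$ be a Fulkerson dual family of $\mathcal B$, let $\mu^*$ be an optimal probability mass function for $\mathrm{MEO}(\mathcal B)$, and let $\eta^*(e)=\sum_{B\ni e}\mu^*(B)$, which is the optimal density for $\mathrm{Mod}_2(\widetilde{\mathcal B})$. Let $\eta^*_{\max}=\max_{e\in E}\eta^*(e)$ and $X=E_{\max}=\{e\in E:\eta^*(e)=\eta^*_{\max}\}$. Then: (1) $X$ is a Beurling set, i.e. $\eta^*(X)=r(E)-r(E\setminus X)$; (2) $\mathrm{cl}(E\setminus X)=E\setminus X$; (3) $\eta^*_{\max}=\dfrac{r(E)-r(E\setminus X)}{|X|}$; (4) $\eta^*_{\max}=1/S(M)$; (5) the contraction $M/(E\setminus E_{\max})$ is homogeneous.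
   Context: A matroid $M=(E,\mathcal I)$ on a finite set $E$ has rank function $r$, base family $\mathcal B$, closure $\mathrm{cl}(Z)=\{y:r(Z\cup\{y\})=r(Z)\}$. Standing assumption: $r(E)>0$. Contraction $M/(E\setminus X)$: matroid on $X$ with rank function $Y\mapsto r(Y\cup(E\setminus X))-r(E\setminus X)$. Strength: $S(M)=\min\{|X|/(r(E)-r(E\setminus X)):X\subseteq E,\ r(E)>r(E\setminus X)\}$. Bases are identified with indicator vectors; $\eta(A)=\sum_{e\in A}\eta(e)$. For $\Gamma\subseteq\mathbb R^F_{\ge0}$ ($F$ finite), $\mathrm{Adm}(\Gamma)=\{\rho\in\mathbb R^F_{\ge0}:\sum_e\gamma(e)\rho(e)\ge1\ \forall\gamma\in\Gamma\}$, $\mathrm{Mod}_2(\Gamma)=\min\{\sum_e\rho(e)^2:\rho\in\mathrm{Adm}(\Gamma)\}$ with unique minimizer (optimal density). $\mathrm{BL}(K)=\{\eta\ge0:\eta^T\rho\ge1\ \forall\rho\in K\}$; $\widetilde{\mathcal B}$ is a Fulkerson dual family of $\mathcal B$ if $\mathrm{Adm}(\widetilde{\mathcal B})=\mathrm{BL}(\mathrm{Adm}(\mathcal B))$. $\mathrm{MEO}(\mathcal B)=\min_\mu\sum_{B,B'}\mu(B)\mu(B')|B\cap B'|$ over pmfs $\mu$ on $\mathcal B$. A matroid $N$ is homogeneous if the optimal density for $\mathrm{Mod}_2$ of a Fulkerson dual family of its base family is constant. *)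

(* Defs.v *)
From HB Require Import structures.
From mathcomp Require Import all_boot all_order all_algebra.
From mathcomp Require Import ring lra.

Set Implicit Arguments.
Unset Strict Implicit.
Unset Printing Implicit Defensive.

Import Order.TTheory GRing.Theory Num.Theory.

(* The ground set is the whole finite type T; a matroid on a proper subset     *)
(* is a matroid on the corresponding subtype.                                 *)
Record matroid (T : finType) := Matroid {
  indep : {set {set T}};
  indep0 : set0 \in indep;
  indep_sub : forall I J : {set T}, I \subset J -> J \in indep -> I \in indep;
  indep_aug : forall I J : {set T}, I \in indep -> J \in indep -> #|I| < #|J| ->
    exists2 e, e \in J :\: I & e |: I \in indep
}.

Section Rank.
Variables (T : finType) (M : matroid T).
Implicit Types A B I Z : {set T}.

Definition rank A : nat := \max_(I in indep M | I \subset A) #|I|.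

Definition bases : {set {set T}} := [set B | maxset [in indep M] B].

Definition matroid_closure Z : {set T} := [set y | rank (y |: Z) == rank Z].

Definition loopless : Prop := forall e : T, [set e] \in indep M.

Lemma rank_ge I A : I \in indep M -> I \subset A -> #|I| <= rank A.
Proof.
by move=> iI sIA; apply: (leq_bigmax_cond (F := fun J : {set T} => #|J|)); rewrite iI.
Qed.

Lemma rank_witness A : exists I, [/\ I \in indep M, I \subset A & #|I| = rank A].
Proof.
have H0 : (set0 \in indep M) && (set0 \subset A) by rewrite indep0 sub0set.
have [|I /andP[iI sI] e] := @eq_bigmax_cond _
  [pred J : {set T} | (J \in indep M) && (J \subset A)] (fun J => #|J|).
  by apply/card_gt0P; exists set0; exact: H0.
by exists I; split => //; rewrite -e.
Qed.

Lemma rank_mono A B : A \subset B -> rank A <= rank B.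
Proof.
move=> sAB; have [I [iI sI <-]] := rank_witness A.
exact: rank_ge iI (subset_trans sI sAB).
Qed.

Lemma rank_setU_leq A B : rank (A :|: B) <= rank A + #|B|.
Proof.
have [I [iI sI <-]] := rank_witness (A :|: B).
rewrite -(cardsID A I) leq_add //.
  by apply: rank_ge (subsetIr _ _); apply: indep_sub iI; exact: subsetIl.
by apply: subset_leq_card; rewrite subDset.
Qed.

Lemma rank_span A B :
  (forall e, e \in B -> rank (e |: A) = rank A) -> rank (A :|: B) = rank A.
Proof.
move=> H; apply/eqP; rewrite eqn_leq (rank_mono (subsetUl A B)) andbT leqNgt.
apply/negP => lt.
have [I [iI sI cI]] := rank_witness A.
have [J [iJ sJ cJ]] := rank_witness (A :|: B).
rewrite -cI -cJ in lt.
have [e /setDP[eJ eI] ieI] := indep_aug iI iJ lt.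
suff : rank A < rank (e |: A).
  case/setUP: (subsetP sJ _ eJ) => [eA|/H -> ]; last by rewrite ltnn.
  by rewrite (setUidPr _) ?sub1set // ltnn.
rewrite -cI; have -> : #|I|.+1 = #|e |: I| by rewrite cardsU1 eI.
by apply: rank_ge ieI _; exact: setUS.
Qed.

End Rank.

Section Contraction.
Variables (T : finType) (M : matroid T) (Z : {set T}).
Local Notation F := {e : T | e \notin Z}.
Implicit Types I J Y : {set F}.
Local Notation rk Y := (rank M (((val : F -> T) @: Y) :|: Z)).

(* I is independent in M / Z iff its contracted rank                           *)
(* r(I u Z) - r(Z) is the cardinality of I.                                   *)
Definition contraction_indep : {set {set F}} :=
  [set I : {set F} | rank M ((val @: I) :|: Z) - rank M Z == #|I|].

Let rkZ Y : rank M Z <= rk Y.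
Proof. exact/rank_mono/subsetUr. Qed.

Let ciE I : (I \in contraction_indep) = (rk I == #|I| + rank M Z).
Proof. by rewrite inE -(eqn_add2r (rank M Z)) subnK. Qed.

Let rkU Y Y' : rk (Y :|: Y') <= rk Y + #|Y'|.
Proof.
rewrite imsetU setUAC; apply: (leq_trans (rank_setU_leq M _ _)).
by rewrite leq_add2l; exact: leq_imset_card.
Qed.

Let rk0 : rk set0 = rank M Z.
Proof. by rewrite imset0 set0U. Qed.

Let rk_leq Y : rk Y <= #|Y| + rank M Z.
Proof. by rewrite addnC -rk0 -{1}[Y]set0U. Qed.

Let rk_span I Y : (forall e, e \in Y -> rk (e |: I) = rk I) -> rk (I :|: Y) = rk I.
Proof.
move=> H; rewrite imsetU setUAC; apply: rank_span => _ /imsetP[e eY ->].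
by rewrite -[in RHS](H e eY) imsetU1 setUA.
Qed.

Let ci_add I e : I \in contraction_indep -> rk (e |: I) != rk I ->
  e \notin I /\ e |: I \in contraction_indep.
Proof.
move=> iI ne.
have eI : e \notin I.
  by apply: contra ne => eI; rewrite (_ : e |: I = I) //;
  apply/setUidPr; rewrite sub1set.
split=> //; rewrite ciE eqn_leq rk_leq cardsU1 eI add1n addSn /=.
move: iI; rewrite ciE => /eqP <-.
by rewrite ltn_neqAle eq_sym ne; apply: rank_mono; rewrite setSU // imsetS // subsetUr.
Qed.

Let contraction_indep0 : set0 \in contraction_indep.
Proof. by rewrite ciE rk0 cards0. Qed.

Let contraction_indep_sub I J :
  I \subset J -> J \in contraction_indep -> I \in contraction_indep.
Proof.
move=> sIJ; rewrite !ciE => /eqP eJ; rewrite eqn_leq rk_leq /=.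
have := rkU I (J :\: I); have -> : I :|: (J :\: I) = J.
  by rewrite -{1}(setIidPr sIJ) setID.
have cJ : #|J| = #|I| + #|J :\: I| by rewrite -(cardsID I J) (setIidPr sIJ).
by rewrite eJ cJ addnAC leq_add2r.
Qed.

Let contraction_indep_aug I J :
  I \in contraction_indep -> J \in contraction_indep -> #|I| < #|J| ->
  exists2 e, e \in J :\: I & e |: I \in contraction_indep.
Proof.
move=> iI iJ lt.
have [/exists_inP[e eJ ne]|/exists_inPn H] :=
  boolP [exists e in J, rk (e |: I) != rk I].
  have [eI ieI] := ci_add iI ne.
  by exists e => //; rewrite inE eI.
have /rk_span eq : forall e, e \in J -> rk (e |: I) = rk I.
  by move=> e /H; rewrite negbK => /eqP.
have : rk J <= rk (I :|: J).
  by apply: rank_mono; rewrite setSU // imsetS // subsetUr.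
move: iI iJ; rewrite eq !ciE => /eqP -> /eqP ->.
by rewrite leq_add2r leqNgt lt.
Qed.

Definition contraction : matroid {e : T | e \notin Z} :=
  Matroid contraction_indep0 contraction_indep_sub contraction_indep_aug.

Lemma rank_contraction Y :
  rank contraction Y = rank M ((val @: Y) :|: Z) - rank M Z.
Proof.
have [I [iI sI cI]] := rank_witness contraction Y.
rewrite -cI; move: (iI); rewrite ciE => /eqP eI.
suff <- : rk I = rk Y by rewrite eI addnK.
rewrite -[Y in RHS](setUidPr sI); symmetry; apply: rk_span => e eY.
apply/eqP/negPn/negP => /(ci_add iI) [eI' ieI].
have : #|e |: I| <= rank contraction Y.
  by apply: rank_ge => //; rewrite subUset sub1set eY.
by rewrite -cI cardsU1 eI' add1n ltnn.
Qed.

End Contraction.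

From mathcomp Require Import classical_sets reals.

Local Open Scope ring_scope.

Section Modulus.
Variables (R : realType) (F : finType).
Implicit Types (Gamma K : set {ffun F -> R}) (rho eta gamma : {ffun F -> R}).

Definition nonneg_orthant : set {ffun F -> R} :=
  [set rho | forall e, 0 <= rho e]%classic.

Definition dot rho eta : R := \sum_e rho e * eta e.

Definition Adm Gamma : set {ffun F -> R} :=
  [set rho | nonneg_orthant rho /\
     forall gamma, Gamma gamma -> 1 <= dot gamma rho]%classic.

Definition BL K : set {ffun F -> R} :=
  [set eta | nonneg_orthant eta /\
     forall rho, K rho -> 1 <= dot eta rho]%classic.

Definition optimal_density Gamma rho : Prop :=
  Adm Gamma rho /\
  forall rho', Adm Gamma rho' -> \sum_e rho e ^+ 2 <= \sum_e rho' e ^+ 2.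

Definition fulkerson_dual Gamma Gamma' : Prop :=
  (Gamma' `<=` nonneg_orthant)%classic /\ Adm Gamma' = BL (Adm Gamma).

Lemma fulkerson_dual_Adm Gamma : fulkerson_dual Gamma (Adm Gamma).
Proof.
split; first by move=> rho [].
have dotC rho eta : dot rho eta = dot eta rho.
  by apply: eq_bigr => e _; rewrite mulrC.
by apply/seteqP; split => rho [rho0 H]; split => // gamma /H; rewrite dotC.
Qed.

Lemma optimal_density_unique Gamma rho rho' :
  optimal_density Gamma rho -> optimal_density Gamma rho' -> rho = rho'.
Proof.
move=> [[a0 aA] aO] [[b0 bA] bO].
have half0 : 0 <= 2^-1 :> R by rewrite invr_ge0.
pose m : {ffun F -> R} := [ffun e => 2^-1 * (rho e + rho' e)].
have mA : Adm Gamma m.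
  split=> [e|g Gg]; first by rewrite ffunE mulr_ge0 // addr_ge0.
  have -> : dot g m = 2^-1 * (dot g rho + dot g rho').
    rewrite /dot -big_split /= mulr_sumr; apply: eq_bigr => e _.
    by rewrite ffunE -mulrDr mulrCA.
  by have := aA _ Gg; have := bA _ Gg; lra.
have eqab : \sum_e rho e ^+ 2 = \sum_e rho' e ^+ 2.
  by apply/eqP; rewrite eq_le aO ?bO //; split.
have par : \sum_e m e ^+ 2 + \sum_e (2^-1 * (rho e - rho' e)) ^+ 2
         = 2^-1 * (\sum_e rho e ^+ 2 + \sum_e rho' e ^+ 2).
  rewrite -!big_split /= mulr_sumr; apply: eq_bigr => e _.
  by rewrite ffunE; field.
have d0 : \sum_e (2^-1 * (rho e - rho' e)) ^+ 2 <= 0.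
  by have := aO _ mA; move: par; rewrite -eqab; lra.
have {}d0 : \sum_e (2^-1 * (rho e - rho' e)) ^+ 2 = 0.
  by apply/eqP; rewrite eq_le d0 sumr_ge0 // => e _; exact: sqr_ge0.
apply/ffunP => e; apply/eqP.
have /eqP := psumr_eq0P (fun e _ => sqr_ge0 (2^-1 * (rho e - rho' e))) d0 (i:=e) isT.
by rewrite sqrf_eq0 mulf_eq0 invr_eq0 pnatr_eq0 subr_eq0.
Qed.

End Modulus.

Section MatroidModulus.
Variables (R : realType) (T : finType) (M : matroid T).
Implicit Types (mu : {ffun {set T} -> R}) (eta : {ffun T -> R}).

Definition indicator (A : {set T}) : {ffun T -> R} := [ffun e => (e \in A)%:R].

Definition base_family : set {ffun T -> R} :=
  [set indicator B | B in [set B | B \in bases M]]%classic.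

(* By fulkerson_dual_Adm and optimal_density_unique, quantifying over every   *)
(* Fulkerson dual family is not vacuous and agrees with picking one.          *)
Definition homogeneous : Prop :=
  forall Gamma, fulkerson_dual base_family Gamma ->
    exists c : R, optimal_density Gamma [ffun=> c].

Definition base_pmf mu : Prop :=
  [/\ forall B, 0 <= mu B,
      forall B, B \notin bases M -> mu B = 0
    & \sum_(B in bases M) mu B = 1].

Definition expected_overlap mu : R :=
  \sum_(B in bases M) \sum_(B' in bases M) mu B * mu B' * #|B :&: B'|%:R.

Definition MEO_optimal mu : Prop :=
  base_pmf mu /\
  forall mu', base_pmf mu' -> expected_overlap mu <= expected_overlap mu'.

Definition edge_probability mu : {ffun T -> R} :=
  [ffun e => \sum_(B in bases M | e \in B) mu B].

Definition rank_drop (X : {set T}) : R :=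
  (rank M [set: T]%SET)%:R - (rank M (~: X)%SET)%:R.

(* The starting value of the minimum is the ratio at X = E, which takes part  *)
(* in the minimum whenever r(E) > 0.                                          *)
Definition strength : R :=
  \big[Num.min/ #|T|%:R / (rank M [set: T]%SET)%:R]_(X : {set T} |
    (rank M (~: X)%SET < rank M [set: T]%SET)%N) (#|X|%:R / rank_drop X).

Definition beurling_set eta (X : {set T}) : Prop :=
  \sum_(e in X) eta e = rank_drop X.

(* Densities are nonnegative, so starting the maximum at 0 is harmless.       *)
Definition max_value eta : R := \big[Num.max/0]_e eta e.

Definition max_set eta : {set T} := [set e | eta e == max_value eta]%SET.

End MatroidModulus.

(* Main.v *)
(* Since the expected overlap of mu is the squared norm of its edge            *)
(* probabilities eta, the vector eta is the point of least norm of the base    *)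
(* polytope, and hence eta . 1_B >= |eta|^2 for every base B.  This one        *)
(* variational inequality has two consequences.  First, eta / |eta|^2 is       *)
(* admissible for the bases, so every vector of the blocker has inner product  *)
(* at least |eta|^2 with eta, and eta is optimal by Cauchy-Schwarz.  Second,   *)
(* every base B charged by mu has least eta-weight, so by exchange B contains  *)
(* a maximal independent subset of the complement of X, the set where eta is   *)
(* maximal.  Averaging |B :&: X| over mu yields (1)-(4), and the sets B :&: X  *)
(* are bases of the contraction to X whose edge probabilities are constant.    *)
Require Import Defs.
From mathcomp Require Import all_boot all_order all_algebra.
From mathcomp Require Import classical_sets reals.
From mathcomp Require Import fintype finset ring lra.

Set Implicit Arguments.
Unset Strict Implicit.
Unset Printing Implicit Defensive.

Import Order.TTheory GRing.Theory Num.Theory.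

Local Open Scope ring_scope.

(** Everything rests on [MEO_variational], a first-order condition at the minimum: moving [mu]
    slightly towards a single base cannot shorten [eta]. With [optimal_density_variational] it makes
    [eta] optimal, and that criterion is applied again to the constant density on the contraction.
    Averaged over [mu] the inequality is an equality, so charged bases have minimal weight
    ([MEO_support_minimal]), and [card_minimal_base_maxset] then fixes how many elements they have
    outside [X]. Strength is the reciprocal of the maximum because rank drop of [A] <= [eta(A)] <=
    [m * #|A|] for every [A], with equality at [X]. *)

Section Bases.
Variables (T : finType) (M : matroid T).
Implicit Types A B I : {set T}.

(** * Bases, and bases of minimal weight *)

Lemma indep_extends I : I \in indep M -> exists2 B, B \in bases M & I \subset B.
Proof.
move=> iI; have [B maxB sIB] := maxset_exists (P := [in indep M]) iI.
by exists B; rewrite // inE.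
Qed.

Lemma basesE B :
  (B \in bases M) = (B \in indep M) && (#|B| == rank M [set: T]%SET)%N.
Proof.
rewrite inE; apply/idP/andP => [maxB|[iB /eqP cB]].
  have iB : B \in indep M by have /maxsetp := maxB.
  split=> //; rewrite eqn_leq rank_ge ?subsetT //= leqNgt; apply/negP => lt.
  have [I [iI _ cI]] := rank_witness M [set: T]%SET; rewrite -cI in lt.
  have [e /setDP[_ eB] ieB] := indep_aug iB iI lt.
  have eqB := maxsetsup maxB ieB (subsetUr _ _).
  by rewrite -eqB setU11 in eB.
apply/maxsetP; split=> // A iA sBA; apply/eqP.
by rewrite eq_sym eqEcard sBA cB rank_ge ?subsetT.
Qed.

Lemma bases_indep B : B \in bases M -> B \in indep M.
Proof. by rewrite basesE => /andP[]. Qed.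

Lemma card_bases B : B \in bases M -> #|B| = rank M [set: T]%SET.
Proof. by rewrite basesE => /andP[_ /eqP]. Qed.

Lemma card_indepD_le B A : B \in indep M -> (#|B :\: A| <= rank M (~: A))%N.
Proof.
by move=> iB; rewrite rank_ge ?setDE ?subsetIr // (indep_sub _ iB) ?subsetIl.
Qed.

Lemma rank_drop_le_card (R : realType) B A : B \in bases M ->
  rank_drop R M A <= #|B :&: A|%:R.
Proof.
move=> bB; rewrite /rank_drop lerBlDr -natrD ler_nat -(card_bases bB).
by rewrite -(cardsID A B) leq_add2l card_indepD_le ?bases_indep.
Qed.

Lemma card_setI_rank_drop (R : realType) B A : B \in bases M ->
  #|B :\: A| = rank M (~: A) -> #|B :&: A|%:R = rank_drop R M A.
Proof.
rewrite /rank_drop => bB <-.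
by rewrite -(card_bases bB) -(cardsID A B) natrD addrK.
Qed.

(** If [B :\: X] were not maximal independent outside [X], it could be enlarged there by some [e]
    and extended to a base. That base keeps all the deficiency of [B] and gains the positive
    deficiency of [e], so it is lighter than [B]. *)
Lemma card_minimal_base_maxset (R : realType) (w : {ffun T -> R}) B :
  B \in bases M ->
  (forall B', B' \in bases M -> \sum_(e in B) w e <= \sum_(e in B') w e) ->
  #|B :\: max_set w| = rank M (~: max_set w).
Proof.
move=> bB minB; apply/eqP; rewrite eqn_leq card_indepD_le ?bases_indep //=.
set X := max_set w; set m := max_value w; rewrite leqNgt; apply/negP => lt.
have w_le e : w e <= m by exact: le_bigmax.
have [I [iI sI cI]] := rank_witness M (~: X); rewrite -cI in lt.
have iBX : B :\: X \in indep M.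
  by apply: indep_sub (subsetDl _ _) (bases_indep bB).
have [e /setDP[eI eBX] ieBX] := indep_aug iBX iI lt.
have eX : e \notin X by have /subsetP/(_ _ eI) := sI; rewrite inE.
have [B' bB' sB'] := indep_extends ieBX.
(* Work with the deficiencies m - w, which vanish exactly on X. *)
have deficE A : A \in bases M -> \sum_(f in A) (m - w f) =
    (rank M [set: T]%SET)%:R * m - \sum_(f in A) w f.
  by move=> bA; rewrite sumrB sumr_const -(card_bases bA) mulr_natl.
have defic_out : \sum_(f in B) (m - w f) = \sum_(f in B :\: X) (m - w f).
  rewrite (big_setID X) /= big1 ?add0r // => f /setIP[_].
  by rewrite inE => /eqP ->; rewrite subrr.
have : \sum_(f in B) (m - w f) < \sum_(f in B') (m - w f).
  rewrite defic_out [ltRHS](big_setID (e |: B :\: X)) /= (setIidPr sB').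
  rewrite big_setU1 //=.
  apply: lt_le_trans (_ : (m - w e) + \sum_(f in B :\: X) (m - w f) <= _).
    rewrite ltrDr subr_gt0 lt_neqAle w_le andbT.
    by move: eX; rewrite inE.
  by rewrite lerDl sumr_ge0 // => f _; rewrite subr_ge0.
by rewrite !deficE //; have := minB _ bB'; lra.
Qed.

End Bases.

(** * A sufficient condition for optimality in a dual family *)

Section VariationalCriterion.
Variables (R : realType) (F : finType).
Implicit Types (Gamma : set {ffun F -> R}) (eta : {ffun F -> R}).

Lemma optimal_density_variational Gamma Gamma' eta :
  fulkerson_dual Gamma Gamma' -> BL (Adm Gamma) eta ->
  0 < \sum_e eta e ^+ 2 ->
  (forall gamma, Gamma gamma -> \sum_e eta e ^+ 2 <= dot gamma eta) ->
  optimal_density Gamma' eta.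
Proof.
set n := \sum_e _ => -[_ dualE] BLeta n_gt0 var.
split=> [|eta']; rewrite dualE // => -[eta'0 BLeta'].
pose rho : {ffun F -> R} := [ffun e => n^-1 * eta e].
have dot_rho g : dot g rho = n^-1 * dot g eta.
  by rewrite /dot mulr_sumr; apply: eq_bigr => e _; rewrite ffunE mulrCA.
have : 1 <= dot eta' rho.
  apply: BLeta'; split=> [e|g Gg].
    by rewrite ffunE mulr_ge0 ?invr_ge0 ?(ltW n_gt0) //; case: BLeta.
  by rewrite dot_rho ler_pdivlMl // mulr1 var.
rewrite dot_rho ler_pdivlMl // mulr1 => le_dot.
have : 0 <= \sum_e (eta' e - eta e) ^+ 2.
  by rewrite sumr_ge0 // => e _; exact: sqr_ge0.
have -> : \sum_e (eta' e - eta e) ^+ 2 =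
    \sum_e eta' e ^+ 2 - 2 * dot eta' eta + n.
  rewrite /dot mulr_sumr -sumrB -big_split /=; apply: eq_bigr => e _.
  by rewrite sqrrB mulr_natl.
by move: le_dot; rewrite -/n; lra.
Qed.

End VariationalCriterion.

(** * Edge probabilities and first-order optimality for MEO *)

Section EdgeProbability.
Variables (R : realType) (T : finType) (M : matroid T).
Implicit Types (mu : {ffun {set T} -> R}) (A B : {set T}).

(** Linearity of expectation: [eta] is the mean indicator of a random base, so pairing it with [f]
    averages the [f]-weight of that base. *)
Lemma edge_probability_average mu (f : T -> R) :
  \sum_e edge_probability M mu e * f e =
  \sum_(B in bases M) mu B * \sum_(e in B) f e.
Proof.
under eq_bigr do rewrite ffunE mulr_suml.
rewrite (exchange_big_dep [in bases M]) /=; last by move=> e B _ /andP[].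
apply: eq_bigr => B bB; rewrite mulr_sumr.
by apply: eq_bigl => e; rewrite bB.
Qed.

Lemma sum_edge_probability mu A :
  \sum_(e in A) edge_probability M mu e =
  \sum_(B in bases M) mu B * #|B :&: A|%:R.
Proof.
have card_sum B : #|B :&: A|%:R = \sum_(e in B) (e \in A)%:R :> R.
  rewrite -sum1_card natr_sum [RHS](big_setID A) /= [X in _ + X]big1 ?addr0.
    by apply: eq_bigr => e /setIP[_ ->].
  by move=> e /setDP[_ /negbTE ->].
under [RHS]eq_bigr do rewrite card_sum.
rewrite big_mkcond /= -edge_probability_average; apply: eq_bigr => e _.
by case: (e \in A); rewrite ?mulr1 ?mulr0.
Qed.

Lemma expected_overlapE mu :
  expected_overlap M mu = \sum_e edge_probability M mu e ^+ 2.
Proof.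
under [RHS]eq_bigr do rewrite expr2.
rewrite edge_probability_average; apply: eq_bigr => B _.
rewrite sum_edge_probability mulr_sumr; apply: eq_bigr => B' _.
by rewrite setIC mulrA.
Qed.

Lemma edge_probability_ge0 mu e : base_pmf M mu -> 0 <= edge_probability M mu e.
Proof. by move=> [mu0 _ _]; rewrite ffunE sumr_ge0. Qed.

Lemma sum_edge_probability_total mu : base_pmf M mu ->
  \sum_e edge_probability M mu e = (rank M [set: T]%SET)%:R.
Proof.
move=> [_ _ mu1]; rewrite -(eq_bigl _ _ (@in_setT T)) sum_edge_probability.
rewrite -[RHS]mul1r -[X in _ = X * _]mu1.
by rewrite mulr_suml; apply: eq_bigr => B bB; rewrite setIT (card_bases bB).
Qed.

Lemma rank_drop_le mu A : base_pmf M mu ->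
  rank_drop R M A <= \sum_(e in A) edge_probability M mu e.
Proof.
move=> [mu0 _ mu1]; rewrite sum_edge_probability -[leLHS]mul1r.
rewrite -[X in X * _ <= _]mu1 mulr_suml.
by apply: ler_sum => B bB; rewrite ler_wpM2l ?rank_drop_le_card.
Qed.

Lemma dot_indicator (w : {ffun T -> R}) B :
  dot (indicator R B) w = \sum_(e in B) w e.
Proof.
rewrite /dot [RHS]big_mkcond; apply: eq_bigr => e _.
by rewrite ffunE; case: (e \in B); rewrite ?mul1r ?mul0r.
Qed.

(** An admissible density has weight at least 1 on every base, hence also on average. *)
Lemma edge_probability_BL mu : base_pmf M mu ->
  BL (Adm (base_family M)) (edge_probability M mu).
Proof.
move=> pmf; have [mu0 _ mu1] := pmf.
split=> [e|rho [_ adm]]; first exact: edge_probability_ge0.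
rewrite /dot edge_probability_average -mu1; apply: ler_sum => B bB.
by rewrite ler_peMr // -dot_indicator adm //; exists B.
Qed.

(** The segment from [mu] to the point mass at [B]; its edge probabilities run from [eta] to the
    indicator of [B]. *)
Definition mix_base mu (t : R) B : {ffun {set T} -> R} :=
  [ffun B' => (1 - t) * mu B' + t * (B' == B)%:R].

Lemma sum_mix_base mu t B (f : {set T} -> R) : B \in bases M ->
  \sum_(B' in bases M) mix_base mu t B B' * f B' =
  (1 - t) * (\sum_(B' in bases M) mu B' * f B') + t * f B.
Proof.
move=> bB; under eq_bigr do rewrite ffunE mulrDl -!mulrA.
rewrite big_split /= -!mulr_sumr; congr (_ + t * _).
rewrite (bigD1 B) //= eqxx mul1r big1 ?addr0 // => B' /andP[_ /negbTE ->].
by rewrite mul0r.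
Qed.

Lemma mix_base_pmf mu t B : base_pmf M mu -> B \in bases M ->
  0 <= t -> t <= 1 -> base_pmf M (mix_base mu t B).
Proof.
move=> [mu0 muN mu1] bB t0 t1; split=> [B'|B' nB'|].
- by rewrite ffunE addr_ge0 ?mulr_ge0 ?subr_ge0.
- rewrite ffunE muN // mulr0 add0r; case: eqP nB' => [->|]; first by rewrite bB.
  by rewrite mulr0.
under eq_bigr do rewrite -[mix_base _ _ _ _]mulr1.
rewrite sum_mix_base //; under eq_bigr do rewrite mulr1.
by rewrite mu1; lra.
Qed.

Lemma edge_probability_mix_base mu t B e : B \in bases M ->
  edge_probability M (mix_base mu t B) e =
  (1 - t) * edge_probability M mu e + t * (e \in B)%:R.
Proof.
have edgeE nu : edge_probability M nu e =
    \sum_(B' in bases M) nu B' * (e \in B')%:R.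
  rewrite ffunE big_mkcondr; apply: eq_bigr => B' _.
  by case: (e \in B'); rewrite ?mulr1 ?mulr0.
by move=> bB; rewrite !edgeE sum_mix_base.
Qed.

Lemma MEO_variational mu B : MEO_optimal M mu -> B \in bases M ->
  \sum_e edge_probability M mu e ^+ 2 <= \sum_(e in B) edge_probability M mu e.
Proof.
move=> [pmf opt] bB; rewrite -dot_indicator.
set eta := edge_probability M mu; set n := \sum_e _; set p := dot _ _.
pose D := \sum_e ((e \in B)%:R - eta e) ^+ 2.
have D_ge0 : 0 <= D by rewrite sumr_ge0 // => e _; exact: sqr_ge0.
(* The bracketed expression times [t] is the exact change in expected overlap along the segment. *)
have descent t : 0 <= t -> t <= 1 -> 0 <= t * (2 * (p - n) + t * D).
  move=> t0 t1; have := opt _ (mix_base_pmf pmf bB t0 t1).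
  rewrite !expected_overlapE -subr_ge0 => /le_trans; apply.
  rewrite /p /n /D /dot -sumrB !mulr_sumr -sumrB mulr_sumr -big_split /= mulr_sumr.
  rewrite le_eqVlt; apply/orP; left; apply/eqP; apply: eq_bigr => e _.
  rewrite edge_probability_mix_base // -/eta [indicator _ _ _]ffunE; ring.
rewrite leNgt; apply/negP => lt_pn.
have den_gt0 : 0 < n - p + D by lra.
(* This step length lies in (0, 1] even when [D] is 0, and gives [t * D < n - p], so the bracket in
   [descent] is negative. *)
pose t := (n - p) / (n - p + D).
have t_gt0 : 0 < t by rewrite divr_gt0 // subr_gt0.
have t_le1 : t <= 1 by rewrite ler_pdivrMr // mul1r lerDl.
have tE : t * (n - p) + t * D = n - p by rewrite -mulrDr divfK // gt_eqF.
have tnp : 0 < t * (n - p) by rewrite mulr_gt0 // subr_gt0.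
have := descent t (ltW t_gt0) t_le1; rewrite pmulr_rge0 //.
by move: tE tnp lt_pn; lra.
Qed.

(** The excesses of base weights over the squared norm of [eta] are nonnegative and average to 0
    under [mu], so they vanish on charged bases. *)
Lemma MEO_support_minimal mu B B' : MEO_optimal M mu ->
  B \in bases M -> B' \in bases M -> mu B != 0 ->
  \sum_(e in B) edge_probability M mu e <=
  \sum_(e in B') edge_probability M mu e.
Proof.
move=> opt bB bB' muB; apply: le_trans (MEO_variational opt bB').
have [[mu0 _ mu1] _] := opt.
set eta := edge_probability M mu; set n := \sum_e _.
have excess0 : \sum_(A in bases M) mu A * (\sum_(e in A) eta e - n) = 0.
  under eq_bigr do rewrite mulrBr.
  rewrite sumrB -mulr_suml mu1 mul1r -edge_probability_average.
  by apply/eqP; rewrite subr_eq0; apply/eqP; apply: eq_bigr => e _; rewrite expr2.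
have excess_ge0 A : A \in bases M -> 0 <= mu A * (\sum_(e in A) eta e - n).
  by move=> bA; rewrite mulr_ge0 // subr_ge0 MEO_variational.
have /eqP := psumr_eq0P excess_ge0 excess0 bB.
by rewrite mulf_eq0 (negbTE muB) /= subr_eq0 => /eqP ->.
Qed.

End EdgeProbability.

(** * The set where the edge probability is maximal *)

Section MaxSet.
Variables (R : realType) (E : finType) (M : matroid E).
Variable mu : {ffun {set E} -> R}.
Hypotheses (rank_gt0 : (0 < rank M [set: E]%SET)%N) (opt : MEO_optimal M mu).

Let eta := edge_probability M mu.
Let X := max_set eta.
Let m := max_value eta.
Let pmf : base_pmf M mu. Proof. by case: opt. Qed.
Let eta_ge0 e : 0 <= eta e. Proof. exact: edge_probability_ge0. Qed.
Let eta_le e : eta e <= m. Proof. exact: le_bigmax. Qed.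

Let rankR_gt0 : 0 < (rank M [set: E]%SET)%:R :> R. Proof. by rewrite ltr0n. Qed.

Lemma max_value_gt0 : 0 < m.
Proof.
rewrite lt_neqAle bigmax_ge_id andbT; apply: contraTneq rankR_gt0 => m0.
rewrite -(sum_edge_probability_total pmf) big1 ?ltxx // => e _.
by apply/eqP; rewrite eq_le eta_ge0 [leRHS]m0 eta_le.
Qed.

Lemma norm_edge_probability_gt0 : 0 < \sum_e eta e ^+ 2.
Proof.
rewrite lt_neqAle sumr_ge0 ?andbT => [|e _]; last exact: sqr_ge0.
apply: contraTneq rankR_gt0 => /esym n0.
rewrite -(sum_edge_probability_total pmf) big1 ?ltxx // => e _; apply/eqP.
by rewrite -sqrf_eq0; apply/eqP/(psumr_eq0P _ n0) => // f _; exact: sqr_ge0.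
Qed.

(** Positivity of [m] rules out that the maximum is attained only by its starting value 0. *)
Lemma max_set_neq0 : (0 < #|X|)%N.
Proof.
rewrite lt0n; apply/negP => /eqP/cards0_eq X0.
suff : m < m by rewrite ltxx.
apply/bigmax_ltP; split=> [|e _]; first exact: max_value_gt0.
rewrite lt_neqAle eta_le andbT; apply/negP => etae.
by have : e \in X by [rewrite inE]; rewrite X0 inE.
Qed.

Lemma card_support_out B : B \in bases M -> mu B != 0 ->
  #|B :\: X| = rank M (~: X).
Proof.
move=> bB muB; apply: card_minimal_base_maxset => // B' bB'.
exact: MEO_support_minimal opt _ _ _.
Qed.

(** Every charged base meets [X] in exactly the rank drop of [X], so the average does too. *)
Lemma max_set_beurling : beurling_set M eta X.
Proof.
have [_ _ mu1] := pmf.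
rewrite /beurling_set sum_edge_probability -[RHS]mul1r.
rewrite -[X in _ = X * _]mu1 mulr_suml.
apply: eq_bigr => B bB; have [->|muB] := eqVneq (mu B) 0; first by rewrite !mul0r.
by rewrite (card_setI_rank_drop R bB) ?card_support_out.
Qed.

Lemma max_value_card : m * #|X|%:R = rank_drop R M X.
Proof.
rewrite -max_set_beurling mulr_natr -sumr_const; apply: eq_bigr => e.
by rewrite inE => /eqP.
Qed.

Lemma max_set_compl_closed : matroid_closure M (~: X) = ~: X.
Proof.
apply/setP => y; rewrite !inE; apply/idP/idP => [rky|yX]; last first.
  by rewrite (setUidPr _) // sub1set !inE.
(* Since [eta y] is positive, some charged base [B] contains [y]. Adding [y] to [B :\: X], which
   already has the full rank of the complement, keeps it independent and so raises the rank. *)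
apply/negP => /eqP etay; have := max_value_gt0; rewrite /m -etay ffunE big1 ?ltxx //.
move=> B /andP[bB yB]; apply/eqP; apply: contraTT rky => muB.
rewrite neq_ltn -(card_support_out bB muB); apply/orP; right.
have yX : y \in X by rewrite inE etay.
have -> : #|B :\: X|.+1 = #|y |: B :\: X|.
  by rewrite cardsU1 !inE -[_ == _]/(_ == m) etay eqxx.
apply: rank_ge; last by rewrite setUS // setDE subsetIr.
by apply: indep_sub (bases_indep bB); rewrite subUset sub1set yB subsetDl.
Qed.

Lemma max_value_strength : m = 1 / strength R M.
Proof.
have m_gt0 := max_value_gt0.
have cX_gt0 : 0 < #|X|%:R :> R by rewrite ltr0n max_set_neq0.
have ratio_ge A : (rank M (~: A) < rank M [set: E]%SET)%N ->
    m^-1 <= #|A|%:R / rank_drop R M A.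
  move=> lt; have drop_gt0 : 0 < rank_drop R M A by rewrite subr_gt0 ltr_nat.
  rewrite ler_pdivlMr // ler_pdivrMl //.
  apply: le_trans (rank_drop_le A pmf) _; rewrite mulr_natr -sumr_const.
  exact: ler_sum.
have ratioX : #|X|%:R / rank_drop R M X = m^-1.
  by rewrite -max_value_card invfM mulrCA divff ?mulr1 // gt_eqF.
have ltX : (rank M (~: X) < rank M [set: E]%SET)%N.
  rewrite -(ltr_nat R) -subr_gt0 -[_ - _]/(rank_drop R M X).
  by rewrite -max_value_card mulr_gt0.
suff -> : strength R M = m^-1 by rewrite div1r invrK.
apply/eqP; rewrite eq_le -{1}ratioX bigmin_le_cond //=.
apply/bigmin_geP; split=> [|A]; last exact: ratio_ge.
(* The starting value of the minimum is the ratio at the whole ground set, so it needs the same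
   lower bound. *)
have rk0 : rank M (~: [set: E]%SET) = 0%N.
  apply/eqP; rewrite setCT -leqn0 -(cards0 E) /rank.
  by apply/bigmax_leqP => I /andP[_ /subset_leq_card].
have := ratio_ge [set: E]%SET; rewrite /rank_drop rk0 subr0 cardsT.
by move=> /(_ rank_gt0).
Qed.

Lemma max_set_contraction_homogeneous : homogeneous R (contraction M (~: X)).
Proof.
have [mu0 _ mu1] := pmf; have m_gt0 := max_value_gt0.
set N := contraction M (~: X).
pose F : finType := {e : E | e \notin ~: X}.
have FX (u : F) : val u \in X by have := valP u; rewrite inE negbK.
have sum_val (g : E -> R) : \sum_(u : F) g (val u) = \sum_(e in X) g e.
  rewrite [RHS](reindex_omap (val : F -> E) insub) /=.
    by apply: eq_bigl => u; rewrite FX valK eqxx.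
  move=> e eX; have eX' : e \notin ~: X by rewrite inE negbK.
  by rewrite insubT.
have valE (A : {set E}) : val @: [set u : F | val u \in A]%SET = A :&: X.
  apply/setP => e; apply/imsetP/setIP => [[u uA ->]|[eA eX]].
    by rewrite FX; move: uA; rewrite inE.
  have eX' : e \notin ~: X by rewrite inE negbK.
  by exists (Sub e eX'); rewrite ?inE SubK.
have cardE (A : {set E}) : #|[set u : F | val u \in A]%SET| = #|A :&: X|.
  by rewrite -valE (card_imset _ val_inj).
have rankN : rank N [set: _]%SET = (rank M [set: E]%SET - rank M (~: X))%N.
  rewrite rank_contraction; congr (rank M _ - _)%N.
  apply/setP => e; rewrite [RHS]inE in_setU; have [|eX] := boolP (e \in ~: X).
    by rewrite orbT.
  by rewrite orbF -[e](SubK F eX) imset_f ?inE.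
have rankNE : (rank N [set: _]%SET)%:R = m * #|X|%:R.
  by rewrite rankN natrB ?rank_mono ?subsetT // max_value_card.
(* [B :\: X] attains the rank of the complement, which leaves [B :&: X] exactly as many elements as
   the rank of the contraction. *)
have base_trace B : B \in bases M -> mu B != 0 ->
    [set u : F | val u \in B]%SET \in bases N.
  move=> bB muB; set I := [set u | _]%SET.
  have cI : #|I| = (rank M [set: E]%SET - rank M (~: X))%N.
    rewrite cardE -(card_support_out bB muB).
    by rewrite -(card_bases bB) -(cardsID X B) addnK.
  rewrite basesE rankN cI eqxx andbT -[indep N]/(contraction_indep _ _) inE cI.
  rewrite valE.
  suff -> : rank M ((B :&: X) :|: ~: X) = rank M [set: E]%SET by [].
  apply/eqP; rewrite eqn_leq rank_mono ?subsetT // -(card_bases bB).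
  rewrite rank_ge ?bases_indep //; apply/subsetP => e eB.
  by rewrite !inE eB /= orbN.
have normE : \sum_(u : F) ([ffun=> m] : {ffun F -> R}) u ^+ 2 =
    m * (m * #|X|%:R).
  under eq_bigr do rewrite ffunE.
  by rewrite (sum_val (fun=> m ^+ 2)) sumr_const expr2 mulrA mulr_natr.
move=> Gamma dual; exists m; apply: (optimal_density_variational dual).
- split=> [u|rho [rho_ge0 adm]]; first by rewrite ffunE ltW.
  (* The trace of an uncharged base may fail to be a base of [N], but then both sides are 0. Summing
     over [B] yields at least 1 for the constant [m] paired with [rho]. *)
  have le_base B : B \in bases M ->
      mu B <= mu B * \sum_(u : F | val u \in B) rho u.
    move=> bB; have [->|muB] := eqVneq (mu B) 0; first by rewrite mul0r.
    pose B' := [set u : F | val u \in B]%SET.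
    have : 1 <= dot (indicator R B') rho.
      by apply: adm; exists B' => //; exact: base_trace.
    rewrite dot_indicator => /le_trans le1; rewrite ler_peMr // le1 //.
    by rewrite le_eqVlt; apply/orP; left; apply/eqP/eq_bigl => u; rewrite inE.
  rewrite -[leLHS]mu1; apply: le_trans (ler_sum _ le_base) _.
  under eq_bigr do rewrite mulr_sumr.
  rewrite (exchange_big_dep xpredT) //= ler_sum // => u _; rewrite ffunE.
  have -> : m = eta (val u) by have := FX u; rewrite inE => /eqP.
  rewrite /eta ffunE mulr_suml le_eqVlt; apply/orP; left; apply/eqP.
  by apply: eq_bigl => B.
- by rewrite normE !mulr_gt0 // ltr0n max_set_neq0.
(* Here the variational inequality is an equality: all bases of [N] have [m * #|X|] elements, so a
   constant density gives them equal weight. *)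
move=> _ [B bB <-]; rewrite normE dot_indicator.
under eq_bigr do rewrite ffunE.
by rewrite sumr_const (card_bases bB) -[leRHS]mulr_natr rankNE.
Qed.

End MaxSet.

Theorem theorem4p1 (R : realType) (E : finType) (M : matroid E)
    (Bdual : set {ffun E -> R}) (mu : {ffun {set E} -> R}) :
  (0 < rank M [set: E]%SET)%N ->
  loopless M ->
  fulkerson_dual (base_family M) Bdual ->
  MEO_optimal M mu ->
  let eta : {ffun E -> R} := edge_probability M mu in
  let X : {set E} := max_set eta in
  optimal_density Bdual eta /\
  [/\ beurling_set M eta X,
      matroid_closure M (~: X)%SET = (~: X)%SET,
      max_value eta =
        ((rank M [set: E]%SET)%:R - (rank M (~: X)%SET)%:R) / #|X|%:R,
      max_value eta = 1 / strength R M
    & homogeneous R (contraction M (~: X)%SET)].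
Proof.
move=> rank_gt0 _ dual opt eta X; split.
  apply: (optimal_density_variational dual).
  - by apply: edge_probability_BL; case: opt.
  - exact: norm_edge_probability_gt0.
  by move=> _ [B bB <-]; rewrite dot_indicator MEO_variational.
split.
- exact: max_set_beurling.
- exact: max_set_compl_closed.
- rewrite -[_ - _]/(rank_drop R M X) -max_value_card // mulfK //.
  by rewrite pnatr_eq0 -lt0n max_set_neq0.
- exact: max_value_strength.
exact: max_set_contraction_homogeneous.
Qed.
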